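(* (1) If $K,T\in\mathcal{R}^n$ then $\left(K^{\circ}+T^{\circ}\right)^{\circ}\in\mathcal{R}^n$. (2) If $K,T\in\mathcal{K}_0^n$ are convex bodies then $\Phi\left(\Phi(K)+\Phi(T)\right)$ is also convex.
   Context: A convex body in $\mathbb{R}^n$ is a closed convex set $K\subseteq\mathbb{R}^n$ with $0\in K$ (not assumed compact, nor with non-empty interior); $\mathcal{K}_0^n$ is the set of all convex bodies. The support function of $K$ is $h_K:S^{n-1}\to[0,\infty]$, $h_K(\theta)=\sup_{x\in K}\langle x,\theta\rangle$, and $K^\circ=\{y\in\mathbb{R}^n:\langle x,y\rangle\le 1\text{ for all }x\in K\}$. A star set is a non-empty $A\subseteq\mathbb{R}^n$ such that $x\in A$ and $0\le\lambda\le1$ imply $\lambda x\in A$; its radial function is $r_A:S^{n-1}\to[0,\infty]$, $r_A(\theta)=\sup\{\lambda\ge0:\lambda\theta\in A\}$. A star body is a star set $A$ with $r_A(\theta)\theta\in A$ for all $\theta\in S^{n-1}$ with $r_A(\theta)<\infty$; it is uniquely determined by $r_A$. For a star body $A$, $\Phi(A)$ is the star body with radial function $r_{\Phi(A)}=1/r_A$ ($1/0=\infty$, $1/\infty=0$). For $g:S^{n-1}\to[0,\infty]$, $A[g]=\{x\in\mathbb{R}^n:\langle x,\theta\rangle\le g(\theta)\text{ for all }\theta\in S^{n-1}\}$. The reciprocal body of $K\in\mathcal{K}_0^n$ is $K'=A[1/h_K]\in\mathcal{K}_0^n$. $\mathcal{R}^n=\{K':K\in\mathcal{K}_0^n\}$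 is the class of reciprocal bodies. The sum $+$ is Minkowski addition; for convex bodies it is $K+T=\overline{\{x+y:x\in K,\ y\in T\}}$ (closure not needed if one of them is compact), and for star bodies it is the usual Minkowski sum. *)

(* Defs.v *)
From mathcomp Require Import all_boot all_order all_algebra.
From mathcomp Require Import all_classical all_reals all_analysis.

Set Implicit Arguments.
Unset Strict Implicit.
Unset Printing Implicit Defensive.

Import Order.TTheory GRing.Theory Num.Theory.
Import numFieldNormedType.Exports.

Local Open Scope classical_set_scope.
Local Open Scope ring_scope.

Section Definitions.
Context {R : realType} {n : nat}.
Implicit Types (x y theta : 'rV[R]_n) (A B K T : set 'rV[R]_n).

Definition dotv x y : R := \sum_(i < n) x 0 i * y 0 i.

(* The library norm on 'rV[R]_n is the sup norm, which induces the Euclidean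
   topology but not the Euclidean sphere. *)
Definition sphere : set 'rV[R]_n := [set theta | dotv theta theta = 1].

Definition convex_body K : Prop := [/\ closed K, convex_set K & K 0].

(* Functions on the sphere with values in [0, +oo] are represented by functions
   on the whole space with values in \bar R; only their restriction to the
   sphere is ever used. *)
Definition support_fun K theta : \bar R :=
  ereal_sup [set (dotv x theta)%:E | x in K].

Definition polar K : set 'rV[R]_n := [set y | forall x, K x -> dotv x y <= 1].

Definition star_set A : Prop :=
  A !=set0 /\ forall x (lambda : R), A x -> 0 <= lambda <= 1 -> A (lambda *: x).

Definition radial A theta : \bar R :=
  ereal_sup [set lambda%:E | lambda in [set l : R | 0 <= l /\ A (l *: theta)]].

Definition star_body A : Prop :=
  star_set A /\
  forall theta, sphere theta -> (radial A theta < +oo)%E ->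
    A (fine (radial A theta) *: theta).

(* The star body with radial function r; the origin is listed separately
   only because the sphere is empty in dimension 0. *)
Definition star_body_of (r : 'rV[R]_n -> \bar R) : set 'rV[R]_n :=
  [set x | x = 0 \/ exists theta (lambda : R),
     [/\ sphere theta, 0 <= lambda, (lambda%:E <= r theta)%E &
         x = lambda *: theta]].

(* The inverse of \bar R satisfies 0^-1 = +oo and +oo^-1 = 0.  Phi is defined
   for every star set, through its radial function: the Minkowski sum of two
   star bodies is a star set, but for unbounded bodies it may fail to contain
   an endpoint r(theta) theta. *)
Definition Phi A : set 'rV[R]_n :=
  star_body_of (fun theta => (radial A theta)^-1%E).

Definition wulff (g : 'rV[R]_n -> \bar R) : set 'rV[R]_n :=
  [set x | forall theta, sphere theta -> ((dotv x theta)%:E <= g theta)%E].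

Definition reciprocal K : set 'rV[R]_n :=
  wulff (fun theta => (support_fun K theta)^-1%E).

Definition reciprocal_body A : Prop :=
  exists2 K, convex_body K & A = reciprocal K.

Definition minkowski_sum A B : set 'rV[R]_n :=
  [set z | exists x y, [/\ A x, B y & z = x + y]].

Definition convex_body_sum K T : set 'rV[R]_n := closure (minkowski_sum K T).

Lemma dotvZ (a b : R) x y : dotv (a *: x) (b *: y) = a * b * dotv x y.
Proof.
by rewrite /dotv mulr_sumr; apply: eq_bigr => i _; rewrite !mxE mulrACA.
Qed.

Lemma star_set0 A : star_set A -> A 0.
Proof. by move=> [[x Ax] /(_ x 0 Ax)]; rewrite scale0r; apply; rewrite lexx ler01. Qed.

Lemma radial_ge0 A theta : star_set A -> (0 <= radial A theta)%E.
Proof.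
move=> /star_set0 A0; apply: ereal_sup_ubound.
by exists 0 => //=; rewrite scale0r.
Qed.

Lemma star_body_ofZ (r : 'rV[R]_n -> \bar R) theta (lambda : R) :
  (forall t, sphere t -> 0 <= r t)%E -> sphere theta -> 0 <= lambda ->
  star_body_of r (lambda *: theta) <-> (lambda%:E <= r theta)%E.
Proof.
move=> r0 th l0; split=> [|lr]; last by right; exists theta, lambda.
case=> [lth0|[t [l [tS l0' lr lE]]]].
  suff -> : lambda = 0 by exact: r0.
  have := dotvZ lambda lambda theta theta; rewrite th lth0 mulr1.
  rewrite -(scale0r theta) dotvZ mul0r mul0r => /esym/eqP.
  by rewrite mulf_eq0 orbb => /eqP.
have /eqP : lambda ^+ 2 = l ^+ 2.
  have := dotvZ lambda lambda theta theta; rewrite th lE dotvZ tS !mulr1.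
  by rewrite !expr2.
rewrite eqrXn2// => /eqP ll; rewrite -{}ll in lE lr.
have [->|ln0] := eqVneq lambda 0; first exact: r0.
by rewrite (scalerI ln0 lE).
Qed.

Lemma radial_star_body_of (r : 'rV[R]_n -> \bar R) theta :
  (forall t, sphere t -> 0 <= r t)%E -> sphere theta ->
  radial (star_body_of r) theta = r theta.
Proof.
move=> r0 th; apply/eqP; rewrite eq_le; apply/andP; split.
  by apply: ge_ereal_sup => _ [l [l0 /star_body_ofZ lr] <-]; exact: lr.
have mem l : 0 <= l -> (l%:E <= r theta)%E ->
    (l%:E <= radial (star_body_of r) theta)%E.
  move=> l0 lr; apply: ereal_sup_ubound; exists l => //=; split=> //.
  exact/star_body_ofZ.
have := r0 _ th; case E : (r theta) mem => [s| |] mem //.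
  by rewrite lee_fin => s0; apply: mem.
move=> _; rewrite leye_eq; apply/eqP/eqyP => A A0.
by apply: mem; [exact: ltW|exact: leey].
Qed.

Lemma star_body_star_body_of (r : 'rV[R]_n -> \bar R) :
  (forall t, sphere t -> 0 <= r t)%E -> star_body (star_body_of r).
Proof.
move=> r0; split; first split; first by exists 0; left.
  move=> _ l [->|[t [k [tS k0 kr ->]]]] /andP[l0 l1].
    by left; rewrite scaler0.
  right; exists t, (l * k); split=> //; rewrite ?mulr_ge0 ?scalerA//.
  by apply: le_trans kr; rewrite lee_fin ler_piMl.
move=> t tS; rewrite radial_star_body_of// => ry; have rt := r0 _ tS.
apply/star_body_ofZ => //; first exact: fine_ge0.
by rewrite fineK// ge0_fin_numE.
Qed.

Lemma radial_Phi A theta : star_set A -> sphere theta ->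
  radial (Phi A) theta = (radial A theta)^-1%E.
Proof.
by move=> sA ?; rewrite radial_star_body_of// => t _; rewrite inve_ge0 radial_ge0.
Qed.

Lemma star_body_Phi A : star_set A -> star_body (Phi A).
Proof.
by move=> sA; apply: star_body_star_body_of => t _; rewrite inve_ge0 radial_ge0.
Qed.

Lemma star_set_minkowski_sum A B :
  star_set A -> star_set B -> star_set (minkowski_sum A B).
Proof.
move=> sA sB; split.
  by exists 0, 0, 0; split; [exact: star_set0|exact: star_set0|rewrite addr0].
move=> _ l [x [y [Ax By ->]]] l01; exists (l *: x), (l *: y).
by split; [exact: sA.2|exact: sB.2|rewrite scalerDr].
Qed.

Lemma convex_body_star_set K : convex_body K -> star_set K.
Proof.
move=> [_ cK K0]; split; first by exists 0.
move=> x l Kx l01.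
have := cK x 0 (Itv01 (andP l01).1 (andP l01).2) (mem_set Kx) (mem_set K0).
by rewrite inE /conv /= scaler0 addr0.
Qed.

End Definitions.

(* Main.v *)
Require Import Defs.
From mathcomp Require Import all_boot all_order all_algebra.
From mathcomp Require Import all_classical all_reals all_analysis.
From mathcomp Require Import ring lra.

(** Write x.y for the inner product.  To a convex body K attach its flower

      F(K) = {z : z.z <= x.z for some x in K},

the union of the balls having the segments [0, x], x in K, as diameters.  Up
to radial endpoints, F(K) is the star body whose radial function is the
support function h_K.  Both statements follow from three facts.

(a) K' = (F(K))^o: writing z = m theta with |theta| = 1, the condition
    z.z <= x.z says m <= x.theta (lemma mem_reciprocal).

(b) Phi(K) and F(K^o) have the same radial function, because
    1 / r_K = h_{K^o}.  This is the bipolar theorem, proved by separating a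
    point from a closed convex set by means of a nearest point
    (separate_point).

(c) Phi(F(K) + F(T)) is a convex body.  The sum of two balls is a ball, so
    F(K) + F(T) is the union, over u in K and v in T, of the balls with centre
    (u + v) / 2 and radius (|u| + |v|) / 2.  All of them contain 0, and Phi
    turns such a ball into {x : c x.x + (u + v).x <= 1} with
    c = (|u||v| - u.v) / 2 >= 0, a convex set.  Since Phi turns unions into
    intersections, the whole image is convex (convex_body_Phi_sum_flower).

The suprema defining radial and support functions need not be attained, so
(b) is not an equality of sets.  The relation shrinks_into A B, meaning that
l A is contained in B for 0 <= l < 1, absorbs this: if A shrinks into B, then
Phi(B) is contained in Phi(A), and B^o in A^o.

For (2), fact (b) gives Phi(Phi(K) + Phi(T)) = Phi(F(K^o) + F(T^o)), which is
convex by (c).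

For (1), let K = K1' and T = T1'.  By (a), K = F(K1)^o and T = F(T1)^o, and
since taking bipolars does not change support functions, (K^o + T^o)^o is
S^o with S = F(K1) + F(T1).  By (c), C = Phi(S) is a convex body; set
L = C^o.  By (b), F(L) has the same radial function as Phi(C) = Phi(Phi(S)),
hence as S.  Therefore L' = F(L)^o = S^o is the reciprocal body sought. *)

Set Implicit Arguments.
Unset Strict Implicit.
Unset Printing Implicit Defensive.

Import Order.TTheory GRing.Theory Num.Theory.
Import numFieldNormedType.Exports.

Local Open Scope classical_set_scope.
Local Open Scope ring_scope.

(** * Inequalities between scalars *)

Section Scalars.
Context {R : realType}.

(** Both Phi and the reciprocal are defined through the inverse of a supremum
    in [0, +oo].  This turns a comparison with such an inverse into real
    inequalities, covering the conventions for the inverses of 0 and +oo.  The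
    index with value 0 makes the supremum nonnegative. *)
Lemma lee_inv_ereal_sup (I : Type) (A : set I) (f : I -> R) (t : R) :
  (exists2 i, A i & f i = 0) ->
  (t%:E <= (ereal_sup [set (f i)%:E | i in A])^-1)%E <->
  t <= 0 \/ forall i, A i -> t * f i <= 1.
Proof.
move=> [i0 Ai0 fi0].
have sup0 : (0 <= ereal_sup [set (f i)%:E | i in A])%E.
  by apply: ereal_sup_ubound; exists i0 => //; rewrite fi0.
have [t0|t0] := leP t 0.
  split=> _; first by left.
  by apply: (@le_trans _ _ 0%E); rewrite ?lee_fin// inve_ge0.
rewrite inve_pge ?inE ?lee_fin ?(ltW t0)// inver gt_eqF//.
split=> [le_sup|[//|ft]]; last first.
  apply: ge_ereal_sup => _ [i Ai <-].
  by rewrite lee_fin -[X in _ <= X]mul1r ler_pdivlMr// mulrC ft.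
right=> i Ai; rewrite mulrC -ler_pdivlMr// mul1r -lee_fin.
by apply: le_trans le_sup; apply: ereal_sup_ubound; exists i.
Qed.

Lemma ler1_of_shrink (a : R) :
  (forall l, 0 <= l < 1 -> l * a <= 1) -> a <= 1.
Proof.
move=> la; rewrite leNgt; apply/negP => a1.
have a0 : 0 < a by lra.
have ai0 : 0 < a^-1 by rewrite invr_gt0.
have ai1 : a^-1 < 1 by rewrite invf_lt1.
have aia : a^-1 * a = 1 by rewrite mulVf ?gt_eqF.
have : (a^-1 + 1) / 2 * a <= 1 by apply: la; lra.
lra.
Qed.

(** With x.x = p, (u + v).x = q and c as in (c), the quadratic inequality says
    that s x lies in a ball containing 0, and s p <= 1 for all such s is the
    condition for x to belong to the image of that ball under Phi.  The largest
    admissible s is the positive root of s^2 p - s q = c, and comparing s p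
    with 1 removes the square root. *)
Lemma quadratic_root_le1 (p q c : R) : 0 < p -> 0 <= c ->
  (forall s, 0 <= s -> s ^+ 2 * p - s * q <= c -> s * p <= 1) <->
  c * p + q <= 1.
Proof.
move=> p0 c0; split=> [H|H s s0 sq]; last first.
  have sp0 : 0 <= s * p by rewrite mulr_ge0// ltW.
  have cp0 : 0 <= c * p by rewrite mulr_ge0// ltW.
  have : (s * p) ^+ 2 - s * p * q <= c * p.
    by rewrite (_ : _ - _ = (s ^+ 2 * p - s * q) * p); [rewrite ler_pM2r|ring].
  nra.
pose d := Num.sqrt (q ^+ 2 + 4 * p * c).
have cp0 : 0 <= c * p by rewrite mulr_ge0// ltW.
have dE : d ^+ 2 = q ^+ 2 + 4 * p * c.
  by rewrite sqr_sqrtr// addr_ge0 ?sqr_ge0// !mulr_ge0// ltW.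
have d0 : 0 <= d by exact: sqrtr_ge0.
have dq : - q <= d by nra.
(* t / p is the largest root of s^2 p - s q = c. *)
pose t := (q + d) / 2.
have tE : t / p * p = t by rewrite divfK// gt_eqF.
have t0 : 0 <= t by rewrite /t; lra.
have root : t ^+ 2 - t * q = c * p by rewrite /t; lra.
have t1 : t <= 1.
  rewrite -tE; apply: H; first by rewrite divr_ge0// ltW.
  rewrite -(ler_pM2r p0) -root -[X in _ <= X ^+ 2 - X * q]tE.
  by rewrite le_eqVlt; apply/orP; left; apply/eqP; ring.
have qt : q <= t.
  have : q <= d by nra.
  by rewrite /t; lra.
nra.
Qed.

End Scalars.

(** * The Euclidean structure *)

Section InnerProduct.
Context {R : realType} {n : nat}.
Implicit Types (x y z u v w : 'rV[R]_n) (l : R).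

Lemma dotvC x y : dotv x y = dotv y x.
Proof. by apply: eq_bigr => i _; rewrite mulrC. Qed.

Lemma dotvDl x y z : dotv (x + y) z = dotv x z + dotv y z.
Proof. by rewrite -big_split; apply: eq_bigr => i _; rewrite !mxE mulrDl. Qed.

Lemma dotvZl l x y : dotv (l *: x) y = l * dotv x y.
Proof. by rewrite -[y in LHS]scale1r dotvZ mulr1. Qed.

Lemma dotvNl x y : dotv (- x) y = - dotv x y.
Proof. by rewrite -scaleN1r dotvZl mulN1r. Qed.

Lemma dotvDr x y z : dotv x (y + z) = dotv x y + dotv x z.
Proof. by rewrite !(dotvC x) dotvDl. Qed.

Lemma dotvZr l x y : dotv x (l *: y) = l * dotv x y.
Proof. by rewrite !(dotvC x) dotvZl. Qed.

Lemma dotvNr x y : dotv x (- y) = - dotv x y.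
Proof. by rewrite !(dotvC x) dotvNl. Qed.

Lemma dot0v x : dotv 0 x = 0.
Proof. by rewrite -(scale0r 0) dotvZl mul0r. Qed.

Lemma dotv0 x : dotv x 0 = 0.
Proof. by rewrite dotvC dot0v. Qed.

Definition dotvE :=
  (dotvDl, dotvDr, dotvNl, dotvNr, dotvZl, dotvZr, dot0v, dotv0).

Lemma dotv_ge0 x : 0 <= dotv x x.
Proof. by apply: sumr_ge0 => i _; rewrite -expr2 sqr_ge0. Qed.

Lemma dotv_coord x i : x 0 i ^+ 2 <= dotv x x.
Proof.
rewrite /dotv (bigD1 i)//= -expr2 lerDl.
by apply: sumr_ge0 => j _; rewrite -expr2 sqr_ge0.
Qed.

Lemma dotv_eq0 x : (dotv x x == 0) = (x == 0).
Proof.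
apply/idP/eqP => [/eqP xx|->]; last by rewrite dot0v.
apply/rowP => i; rewrite !mxE; apply/eqP; rewrite -sqrf_eq0 eq_le sqr_ge0 andbT.
by rewrite -xx dotv_coord.
Qed.

Lemma dotv_gt0 x : x != 0 -> 0 < dotv x x.
Proof. by move=> x0; rewrite lt_def dotv_eq0 x0 dotv_ge0. Qed.

Definition enorm x : R := Num.sqrt (dotv x x).

Lemma enorm_ge0 x : 0 <= enorm x. Proof. exact: sqrtr_ge0. Qed.

Lemma sqr_enorm x : enorm x ^+ 2 = dotv x x.
Proof. by rewrite sqr_sqrtr// dotv_ge0. Qed.

Lemma polar_decomposition x : x != 0 ->
  exists theta m, [/\ sphere theta, 0 < m & x = m *: theta].
Proof.
move=> x0; have m0 : 0 < enorm x by rewrite sqrtr_gt0 dotv_gt0.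
exists ((enorm x)^-1 *: x), (enorm x); split=> //; last first.
  by rewrite scalerA divff ?scale1r// gt_eqF.
by rewrite /sphere /= dotvZ -sqr_enorm -invfM -expr2 mulVf// expf_neq0// gt_eqF.
Qed.

(** Stated with upper bounds for the norms, the form in which it applies to
    points of balls of given radii. *)
Lemma cauchy_schwarz x y (a b : R) : 0 <= a -> 0 <= b ->
  dotv x x <= a ^+ 2 -> dotv y y <= b ^+ 2 -> dotv x y <= a * b.
Proof.
move=> a0 b0 xa yb.
have [a00|an0] := eqVneq a 0.
  have /eqP : dotv x x = 0.
    by apply/eqP; rewrite eq_le dotv_ge0 andbT (le_trans xa)// a00 expr2 mul0r.
  by rewrite dotv_eq0 => /eqP ->; rewrite dot0v mulr_ge0.
have [b00|bn0] := eqVneq b 0.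
  have /eqP : dotv y y = 0.
    by apply/eqP; rewrite eq_le dotv_ge0 andbT (le_trans yb)// b00 expr2 mul0r.
  by rewrite dotv_eq0 => /eqP ->; rewrite dotv0 mulr_ge0.
have ap : 0 < a by rewrite lt_def an0.
have bp : 0 < b by rewrite lt_def bn0.
have ab : 0 < a * b by rewrite mulr_gt0.
have := dotv_ge0 (b *: x - a *: y); rewrite !dotvE (dotvC y x) => H.
have Hx : b * (b * dotv x x) <= (a * b) ^+ 2.
  by rewrite mulrA exprMn mulrC ler_pM2r ?mulr_gt0// expr2.
have Hy : a * (a * dotv y y) <= (a * b) ^+ 2.
  by rewrite mulrA exprMn expr2 ler_pM2l ?mulr_gt0.
rewrite -(ler_pM2l ab); nra.
Qed.

Lemma dotv_continuous u : continuous (dotv u : 'rV[R]_n -> R).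
Proof.
apply: (@continuous_big R _ +%R 0 xpredT _ _ _
  (fun i (y : 'rV[R]_n) => u 0 i * y 0 i)); first exact: add_continuous.
move=> i _ x; apply: continuousM; first exact: cst_continuous.
exact: coord_continuous.
Qed.

Lemma sqr_enorm_continuous : continuous (fun x => dotv x x : R).
Proof.
apply: (@continuous_big R _ +%R 0 xpredT _ _ _
  (fun i (y : 'rV[R]_n) => y 0 i * y 0 i)); first exact: add_continuous.
by move=> i _ x; apply: continuousM; exact: coord_continuous.
Qed.

Lemma sqr_dist_continuous w : continuous (fun x => dotv (x - w) (x - w) : R).
Proof.
move=> x; apply: (@continuous_comp _ _ _ (fun x => x - w) (fun x => dotv x x)).
  by apply: continuousB; [exact: cvg_id|exact: cst_continuous].
exact: sqr_enorm_continuous.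
Qed.

End InnerProduct.

(** * Separating a point from a convex body *)

Section Separation.
Context {R : realType} {n : nat}.
Implicit Types (x y z u v w : 'rV[R]_n) (l : R) (K : set 'rV[R]_n).

Lemma convex_setP K : convex_set K <->
  forall x y l, 0 <= l <= 1 -> K x -> K y -> K (l *: x + (1 - l) *: y).
Proof.
split=> [cK x y l /andP[l0 l1] Kx Ky|cK x y l].
  by have := cK x y (Itv01 l0 l1) (mem_set Kx) (mem_set Ky); rewrite inE.
rewrite !inE => Kx Ky; rewrite /conv /=; apply: cK => //.
by rewrite ge0 le1.
Qed.

(** A Euclidean ball of squared radius c lies in the coordinate box of
    half-width 1 + c, since |t| <= 1 + t^2. *)
Lemma compact_sqr_enorm_sublevel w (c : R) :
  compact [set x : 'rV[R]_n | dotv (x - w) (x - w) <= c].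
Proof.
apply: (@subclosed_compact _ _
    [set v : 'rV[R]_n |
      forall i, `[w 0 i - (1 + c), w 0 i + (1 + c)]%classic (v 0 i)]).
- apply: (@closed_comp _ _ (fun x => dotv (x - w) (x - w)) [set a | a <= c]).
    by move=> x _; exact: sqr_dist_continuous.
  exact: closed_le.
- exact: (@rV_compact _ _ (fun i => `[w 0 i - (1 + c), w 0 i + (1 + c)]%classic)
     (fun i => @segment_compact _ _ _)).
move=> x /= xc i; rewrite in_itv /=.
have := le_trans (dotv_coord (x - w) i) xc; rewrite !mxE.
set d := x 0 i - w 0 i => dc.
have := sqr_ge0 (d - 1 / 2); have := sqr_ge0 (d + 1 / 2).
by move: dc; rewrite /d => *; apply/andP; split; lra.
Qed.

Lemma nearest_point K w : closed K -> K 0 ->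
  exists2 p, K p &
    forall x, K x -> dotv (p - w) (p - w) <= dotv (x - w) (x - w).
Proof.
move=> clK K0; pose f x := dotv (x - w) (x - w).
(* K may be unbounded; since 0 is in K, the minimum is attained on the part of
   K that is no farther from w than 0 is. *)
pose A := K `&` [set x | f x <= f 0].
have A0 : A 0 by split=> /=.
have cA : compact A.
  rewrite /A setIC; apply: compact_closedI => //.
  exact: compact_sqr_enorm_sublevel.
have [|p /[!inE] -[Kp _] pmin] := @EVT_min_rV R n f A (ex_intro _ _ A0) cA.
  by apply: continuous_subspaceT; exact: sqr_dist_continuous.
exists p => // x Kx; have [xf|xf] := leP (f x) (f 0).
  by apply: pmin; rewrite inE.
by apply: le_trans (ltW xf); apply: pmin; rewrite inE.
Qed.

Lemma nearest_point_obtuse K w p : convex_set K -> K p ->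
  (forall x, K x -> dotv (p - w) (p - w) <= dotv (x - w) (x - w)) ->
  forall x, K x -> dotv (x - p) (w - p) <= 0.
Proof.
move=> /convex_setP cK Kp pmin x Kx; rewrite leNgt; apply/negP => b0.
set b := dotv (x - p) (w - p) in b0.
pose a := dotv (x - p) (x - p).
have a0 : 0 <= a := dotv_ge0 _.
(* Compares the distances to w of p and of p + l (x - p). *)
have step l : 0 <= l <= 1 -> 2 * l * b <= l ^+ 2 * a.
  move=> l01; have := pmin _ (cK x p l l01 Kx Kp).
  have -> : l *: x + (1 - l) *: p - w = l *: (x - p) - (w - p).
    by apply/rowP => i; rewrite !mxE; ring.
  rewrite -(opprB w p) /a /b; move: (w - p) (x - p) => d e.
  by rewrite !dotvE (dotvC d e); lra.
(* The best step is l = b / a, cut off at 1. *)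
have [ab|ba] := leP a b.
  have := step 1; rewrite ler01 lexx => /(_ isT); nra.
have ap : 0 < a by lra.
have baE : b / a * a = b by rewrite divfK// gt_eqF.
set l := b / a in baE.
have l0 : 0 < l by rewrite divr_gt0.
have l1 : l <= 1 by rewrite ler_pdivrMr// mul1r ltW.
have := step l; rewrite (ltW l0) l1 => /(_ isT).
rewrite (_ : l ^+ 2 * a = l * (l * a)); last by ring.
rewrite baE; nra.
Qed.

(** If p is the point of K nearest to w and d = w - p, then x.d <= p.d for x in
    K while w.d = p.d + d.d.  Dividing d by a value strictly between these two
    bounds gives the functional y; the value is positive because 0 is in K. *)
Lemma separate_point K w : convex_body K -> ~ K w ->
  exists2 y, polar K y & 1 < dotv y w.
Proof.
move=> [clK cK K0] Kw; have [p Kp pmin] := nearest_point w clK K0.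
have obtuse := nearest_point_obtuse cK Kp pmin.
pose d := w - p; pose a := dotv d d; pose b := dotv p d.
have a0 : 0 < a.
  apply: dotv_gt0; apply/eqP => /subr0_eq wp; apply: Kw.
  by rewrite wp.
have b0 : 0 <= b by have := obtuse _ K0; rewrite sub0r dotvNl oppr_le0.
have c0 : 0 < b + a / 2 by lra.
exists ((b + a / 2)^-1 *: d) => [x Kx|].
  rewrite dotvZr mulrC ler_pdivrMr// mul1r.
  have := obtuse x Kx; rewrite dotvDl dotvNl -/d -/b; lra.
rewrite dotvZl mulrC ltr_pdivlMr// mul1r.
have -> : dotv d w = a + b by rewrite /a /b (dotvC p) -dotvDr subrK.
lra.
Qed.

End Separation.

(** * Examples of convex bodies *)

Section ConvexBodies.
Context {R : realType} {n : nat}.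
Implicit Types (a d x y z u v w : 'rV[R]_n) (l : R) (K T A B : set 'rV[R]_n).

Lemma convex_body_bigcap (I : Type) (P : set I) (F : I -> set 'rV[R]_n) :
  (forall i, P i -> convex_body (F i)) -> convex_body (\bigcap_(i in P) F i).
Proof.
move=> bF; split.
- by apply: closed_bigI => i Pi; have [] := bF i Pi.
- apply/convex_setP => x y l l01 Fx Fy i Pi.
  by have [_ /convex_setP cF _] := bF i Pi; apply: cF; [|exact: Fx|exact: Fy].
by move=> i Pi; have [] := bF i Pi.
Qed.

(** These are the images under Phi of the balls containing 0; half-spaces are
    the case c = 0. *)
Lemma convex_body_quadric (c : R) a : 0 <= c ->
  convex_body [set x | c * dotv x x + dotv a x <= 1].
Proof.
move=> c0; split.
- apply: (@closed_comp _ _ (fun x => c * dotv x x + dotv a x) [set r | r <= 1]).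
    move=> x _; apply: (@continuousD _ _ _ (fun x => c * dotv x x) (dotv a));
      last exact: dotv_continuous.
    apply: (@continuousM _ _ (cst c)); first exact: cst_continuous.
    exact: sqr_enorm_continuous.
  exact: closed_le.
- apply/convex_setP => x y l /andP[l0 l1] /= Hx Hy.
  have := dotv_ge0 (x - y); rewrite !dotvE (dotvC y x) => xy0.
  have m0 : 0 <= l * (1 - l) by rewrite mulr_ge0// subr_ge0.
  have := mulr_ge0 (mulr_ge0 c0 m0) xy0.
  have : l * (c * dotv x x + dotv a x) <= l * 1 by rewrite ler_wpM2l.
  have : (1 - l) * (c * dotv y y + dotv a y) <= (1 - l) * 1.
    by rewrite ler_wpM2l// subr_ge0.
  lra.
by rewrite /= !dotv0 mulr0 addr0.
Qed.

Lemma convex_body_polar K : convex_body (polar K).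
Proof.
have -> : polar K = \bigcap_(x in K) [set y | 0 * dotv y y + dotv x y <= 1].
  by apply/seteqP; split=> y Ky x /Ky /=; rewrite mul0r add0r.
by apply: convex_body_bigcap => x _; exact: convex_body_quadric.
Qed.

End ConvexBodies.

(** * Membership in Phi, in the reciprocal and in flowers *)

Section Flowers.
Context {R : realType} {n : nat}.
Implicit Types (a d x y z u v w : 'rV[R]_n) (l : R) (K T A B : set 'rV[R]_n).

(** The condition z.z <= x.z is membership in the ball with diameter [0, x]. *)
Definition flower K : set 'rV[R]_n :=
  [set z | exists2 x, K x & dotv z z <= dotv x z].

Lemma flower0 K : K 0 -> flower K 0.
Proof. by move=> K0; exists 0 => //; rewrite !dotv0. Qed.

Lemma star_set_flower K : K 0 -> star_set (flower K).
Proof.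
move=> K0; split; first by exists 0; exact: flower0.
move=> z l [x Kx xz] /andP[l0 l1]; exists x => //.
rewrite !dotvE; apply: ler_wpM2l => //; apply: le_trans xz.
by rewrite ler_piMl// dotv_ge0.
Qed.

(** Describes Phi without unit vectors: for x = m theta with m > 0, the
    condition m <= 1 / r_A(theta) says that t m <= 1 as soon as t theta is in
    A, and t = s m when t theta = s x. *)
Lemma mem_Phi A x : star_set A ->
  Phi A x <-> forall s, 0 <= s -> A (s *: x) -> s * dotv x x <= 1.
Proof.
move=> sA; have [->|x0] := eqVneq x 0.
  by split=> [_ s _ _|_]; [rewrite dotv0 mulr0|left].
have [theta [m [th m0 ->]]] := polar_decomposition x0.
rewrite /Phi star_body_ofZ ?(ltW m0)//; last first.
  by move=> t _; rewrite inve_ge0 radial_ge0.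
rewrite /radial lee_inv_ereal_sup; last first.
  by exists 0 => //=; rewrite scale0r; split => //; exact: star_set0.
rewrite dotvZ th mulr1; split=> [[m_le0|H] s s0|H].
- by move: m_le0; rewrite leNgt m0.
- rewrite scalerA => As; rewrite mulrA mulrC; apply: H; split=> //.
  by rewrite mulr_ge0// ltW.
right=> s [s0 As]; have := H (s / m).
rewrite scalerA mulrA divfK ?gt_eqF// [s * m]mulrC; apply=> //.
by rewrite divr_ge0// ltW.
Qed.

(** For x in K and a unit vector theta with x.theta > 0, the point
    (x.theta) theta is the farthest point of F(K) in the direction theta that x
    contributes.  Hence y.theta <= 1 / h_K(theta) for all theta exactly when y
    is in the polar of F(K). *)
Lemma mem_reciprocal K y : K 0 ->
  reciprocal K y <-> polar (flower K) y.
Proof.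
move=> K0; have hK theta : (exists2 x, K x & dotv x theta = 0).
  by exists 0; rewrite ?dot0v.
split=> [Ky z [x Kx zx]|Hy theta th]; last first.
  apply/lee_inv_ereal_sup => //.
  have [t0|t0] := leP (dotv y theta) 0; [by left|right=> x Kx].
  have [e0|e0] := leP (dotv x theta) 0.
    by apply: (@le_trans _ _ 0) => //; rewrite mulr_ge0_le0// ltW.
  have := Hy (dotv x theta *: theta); rewrite dotvZl mulrC (dotvC theta).
  by apply; exists x => //; rewrite dotvZ th mulr1 dotvZr.
have [->|z0] := eqVneq z 0; first by rewrite dot0v.
have [theta [m [th m0 zE]]] := polar_decomposition z0.
have := Ky theta th; rewrite /support_fun.
move=> /(lee_inv_ereal_sup _ (hK theta)) H.
rewrite zE dotvZl (dotvC theta).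
have mx : m <= dotv x theta.
  by move: zx; rewrite zE dotvZ th dotvZr mulr1 ler_pM2l.
have [t0|t0] := leP (dotv y theta) 0.
  by apply: (@le_trans _ _ 0) => //; rewrite mulr_ge0_le0// ltW.
case: H => [|/(_ x Kx)]; first by rewrite leNgt t0.
by apply: le_trans; rewrite mulrC ler_pM2l.
Qed.

End Flowers.

(** * Sets with the same radial function *)

Section Shrinking.
Context {R : realType} {n : nat}.
Implicit Types (a d x y z u v w : 'rV[R]_n) (l : R) (K T A B : set 'rV[R]_n).

(** For star sets, says that the radial function of A is at most that of B,
    whether or not the sets contain their radial endpoints. *)
Definition shrinks_into A B := forall l z, 0 <= l < 1 -> A z -> B (l *: z).

Lemma subset_shrinks_into A B : star_set A -> A `<=` B -> shrinks_into A B.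
Proof.
move=> sA AB l z /andP[l0 l1] Az; apply: AB; apply: sA.2 => //.
by rewrite l0 ltW.
Qed.

Lemma sub_shrinks_into_trans B A C :
  A `<=` B -> shrinks_into B C -> shrinks_into A C.
Proof. by move=> AB BC l z l01 /AB /BC; exact. Qed.

Lemma shrinks_into_sum A B A' B' : shrinks_into A A' -> shrinks_into B B' ->
  shrinks_into (minkowski_sum A B) (minkowski_sum A' B').
Proof.
move=> AA' BB' l _ l01 [x [y [Ax By ->]]]; exists (l *: x), (l *: y).
by split; [exact: AA'|exact: BB'|rewrite scalerDr].
Qed.

Lemma polar_shrinks_into A B : shrinks_into A B -> polar B `<=` polar A.
Proof.
move=> AB y By x Ax; apply: ler1_of_shrink => l l01.
by rewrite -dotvZl; apply: By; exact: AB.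
Qed.

Lemma Phi_shrinks_into A B : star_set A -> star_set B ->
  shrinks_into A B -> Phi B `<=` Phi A.
Proof.
move=> sA sB AB x /(mem_Phi _ sB) Bx; apply/(mem_Phi _ sA) => s s0 As.
apply: ler1_of_shrink => l l01; rewrite mulrA; apply: Bx.
  by rewrite mulr_ge0//; case/andP: l01.
by rewrite -scalerA; exact: AB.
Qed.

Lemma flower_polar_sub_Phi K : star_set K -> flower (polar K) `<=` Phi K.
Proof.
move=> sK z [x Kx zx]; apply/(mem_Phi _ sK) => s s0 Ks.
by apply: le_trans (Kx _ Ks); rewrite dotvZl (dotvC z); exact: ler_wpM2l.
Qed.

(** The hard half of the bipolar theorem.  For z in Phi(K) and 0 < l < 1, the
    point z / (l z.z) is outside K, and a functional separating it from K is a
    point x of the polar of K with l z.z < x.z. *)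
Lemma Phi_shrinks_into_flower K : convex_body K ->
  shrinks_into (Phi K) (flower (polar K)).
Proof.
move=> bK l z /andP[l0 l1] /(mem_Phi _ (convex_body_star_set bK)) Kz.
have F0 : flower (polar K) 0 by apply: flower0; have [] := convex_body_polar K.
have [->|ln0] := eqVneq l 0; first by rewrite scale0r.
have [->|z0] := eqVneq z 0; first by rewrite scaler0.
have lp : 0 < l * dotv z z by rewrite mulr_gt0 ?dotv_gt0// lt_def ln0.
have Kw : ~ K ((l * dotv z z)^-1 *: z).
  move=> /Kz; rewrite invr_ge0 (ltW lp) => /(_ isT).
  rewrite invfM -mulrA mulVf ?mulr1 ?gt_eqF ?dotv_gt0//.
  by rewrite leNgt invf_gt1 ?l1// lt_def ln0.
have [x Kx xz] := separate_point bK Kw; exists x => //.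
rewrite dotvZr ltr_pdivlMl// mulr1 in xz.
by rewrite dotvZ dotvZr -mulrA ler_wpM2l// ltW.
Qed.

Lemma sub_PhiPhi A : star_set A -> A `<=` Phi (Phi A).
Proof.
move=> sA z Az; have sPA := (star_body_Phi sA).1.
apply/(mem_Phi _ sPA) => s; rewrite le_eqVlt => /predU1P[<-|s0].
  by rewrite mul0r.
move=> /(mem_Phi _ sA)/(_ s^-1); rewrite invr_ge0 (ltW s0) => /(_ isT).
rewrite scalerA mulVf ?gt_eqF// scale1r => /(_ Az).
by rewrite dotvZ -mulrA mulKf// gt_eqF.
Qed.

(** For z <> 0 and 0 < l < 1: if l z is not in A, then r_A <= l |z| in the
    direction of z, so that the multiple t z with t z.z = 1 / l belongs to
    Phi(A).  As t z.z > 1, this prevents z from being in Phi(Phi(A)). *)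
Lemma PhiPhi_shrinks_into A : star_set A -> shrinks_into (Phi (Phi A)) A.
Proof.
move=> sA l z /andP[l0 l1] /(mem_Phi _ (star_body_Phi sA).1) Az.
have [->|ln0] := eqVneq l 0; first by rewrite scale0r; exact: star_set0.
have [->|z0] := eqVneq z 0; first by rewrite scaler0; exact: star_set0.
have lp : 0 < l by rewrite lt_def ln0.
have pp := dotv_gt0 z0; apply: contrapT => nA.
pose t := (l * dotv z z)^-1.
have t0 : 0 < t by rewrite invr_gt0 mulr_gt0.
have tpE : t * dotv z z = l^-1 by rewrite /t invfM -mulrA mulVf ?mulr1// gt_eqF.
have : t * dotv z z <= 1; last by rewrite tpE leNgt invf_gt1 ?l1.
apply: Az; first exact: ltW.
apply/(mem_Phi _ sA) => s s0; rewrite scalerA => As.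
have stl : s * t <= l.
  rewrite leNgt; apply/negP => lst; apply: nA.
  have st0 : 0 < s * t by exact: lt_trans lst.
  have := sA.2 _ (l / (s * t)) As; rewrite scalerA divfK ?gt_eqF//; apply.
  by rewrite divr_ge0 ?(ltW st0)// ler_pdivrMr// mul1r ltW.
rewrite dotvZ -mulrA tpE mulrA -[leRHS](@mulfV _ l)//.
by rewrite ler_pM2r// invr_gt0.
Qed.

End Shrinking.

(** * Sums of flowers *)

Section FlowerSum.
Context {R : realType} {n : nat}.
Implicit Types (a d x y z u v w : 'rV[R]_n) (l : R) (K T A B : set 'rV[R]_n).

(** Completes the square: z.z <= u.z is the ball with diameter [0, u]. *)
Lemma mem_flower_ball u z :
  (dotv z z <= dotv u z) =
  (dotv (z - 2^-1 *: u) (z - 2^-1 *: u) <= (enorm u / 2) ^+ 2).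
Proof.
rewrite exprMn sqr_enorm !dotvE (dotvC z u).
by apply/idP/idP => ?; lra.
Qed.

(** Splits a displacement of length at most a + b into parts of lengths at most
    a and b; stated without division so as to cover a = b = 0. *)
Lemma ball_sum_split (a b : R) : 0 <= a -> 0 <= b ->
  exists k, k * (a + b) = a /\ (1 - k) * (a + b) = b.
Proof.
move=> a0 b0; have [ab|ab] := eqVneq (a + b) 0; first by exists 0; split; lra.
by exists (a / (a + b)); rewrite mulrBl mul1r divfK//; split=> //; lra.
Qed.

(** The inequality is that of the ball with centre (u + v) / 2 and radius
    (|u| + |v|) / 2, the sum of the balls with diameters [0, u] and [0, v]. *)
Lemma mem_sum_flower K T w : minkowski_sum (flower K) (flower T) w <->
  exists u v, [/\ K u, T v &
    dotv w w - dotv (u + v) w <= (enorm u * enorm v - dotv u v) / 2].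
Proof.
split=> [[z1 [z2 [[u Ku z1u] [v Tv z2v] ->]]]|[u [v [Ku Tv uv]]]].
  exists u, v; split=> //; move: z1u z2v; rewrite !mem_flower_ball => z1u z2v.
  have u0 := enorm_ge0 u; have v0 := enorm_ge0 v.
  have := cauchy_schwarz _ _ z1u z2v.
  rewrite !divr_ge0// => /(_ isT isT).
  move: z1u z2v; rewrite !exprMn !sqr_enorm !dotvE.
  rewrite (dotvC z1 u) (dotvC z1 v) (dotvC z2 v) (dotvC z2 z1).
  lra.
pose d := w - 2^-1 *: (u + v); pose r := enorm u + enorm v.
have [k [kr k'r]] := ball_sum_split (enorm_ge0 u) (enorm_ge0 v).
have dr : dotv d d <= (r / 2) ^+ 2.
  move: uv; rewrite /d exprMn /r sqrrD !sqr_enorm !dotvE.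
  by rewrite (dotvC w u) (dotvC w v) (dotvC v u); lra.
exists (2^-1 *: u + k *: d), (2^-1 *: v + (1 - k) *: d); split.
- exists u => //; rewrite mem_flower_ball addrC addKr dotvZ -kr -/r.
  rewrite -expr2 (_ : (k * r / 2) ^+ 2 = k ^+ 2 * (r / 2) ^+ 2); last by ring.
  by rewrite ler_wpM2l// sqr_ge0.
- exists v => //; rewrite mem_flower_ball addrC addKr dotvZ -k'r -/r.
  rewrite -expr2 (_ : ((1 - k) * r / 2) ^+ 2 = (1 - k) ^+ 2 * (r / 2) ^+ 2);
    last by ring.
  by rewrite ler_wpM2l// sqr_ge0.
by apply/rowP => i; rewrite /d !mxE; field.
Qed.

(** By mem_Phi, Phi of a union of balls is the intersection of the images of
    these balls, and quadratic_root_le1 computes each image. *)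
Lemma convex_body_Phi_sum_flower K T : K 0 -> T 0 ->
  convex_body (Phi (minkowski_sum (flower K) (flower T))).
Proof.
move=> K0 T0.
have sS := star_set_minkowski_sum (star_set_flower K0) (star_set_flower T0).
pose c u v : R := (enorm u * enorm v - dotv u v) / 2.
have c0 u v : 0 <= c u v.
  rewrite divr_ge0// subr_ge0; apply: cauchy_schwarz; rewrite ?enorm_ge0//.
    by rewrite sqr_enorm.
  by rewrite sqr_enorm.
have -> : Phi (minkowski_sum (flower K) (flower T)) =
    \bigcap_(uv in K `*` T)
      [set x | c uv.1 uv.2 * dotv x x + dotv (uv.1 + uv.2) x <= 1].
  apply/seteqP; split=> x.
    move=> /(mem_Phi _ sS) Sx [u v] [/= Ku Tv].
    have [->|x0] := eqVneq x 0; first by rewrite !dotv0 mulr0 addr0.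
    apply/(quadratic_root_le1 _ (dotv_gt0 x0) (c0 _ _)) => s s0 Hs.
    apply: Sx => //; apply/mem_sum_flower; exists u, v; split=> //.
    by rewrite dotvZ -expr2 dotvZr.
  move=> Hx; apply/(mem_Phi _ sS) => s s0 /mem_sum_flower[u [v [Ku Tv]]].
  have [->|x0] := eqVneq x 0; first by rewrite dotv0 mulr0.
  rewrite dotvZ -expr2 dotvZr; move: s s0.
  apply/(quadratic_root_le1 _ (dotv_gt0 x0) (c0 _ _)).
  exact: (Hx (u, v)).
by apply: convex_body_bigcap => uv _; exact: convex_body_quadric.
Qed.

End FlowerSum.

(** * Polars of sums *)

Section PolarSum.
Context {R : realType} {n : nat}.
Implicit Types (a d x y z u v w : 'rV[R]_n) (l : R) (K T A B : set 'rV[R]_n).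

Lemma polar_closure A : polar (closure A) = polar A.
Proof.
apply/seteqP; split=> y Ay x.
  by move=> Ax; apply: Ay; exact: subset_closure.
suff : closure A `<=` [set x | dotv x y <= 1] by apply.
have cl : closed [set x | dotv x y <= 1].
  rewrite (_ : mkset _ = dotv y @^-1` [set r | r <= 1]); last first.
    by apply/seteqP; split=> z /=; rewrite dotvC.
  by apply: closed_comp; [move=> z _; exact: dotv_continuous|exact: closed_le].
by rewrite closureE; apply: smallest_sub => // z Az; exact: Ay.
Qed.

(** A set containing 0 and its bipolar have the same support function.  If
    m > 0, then y / m is in the polar of A; if m = 0, so are all positive multiples
    of y. *)
Lemma bipolar_halfspace A y (m : R) : A 0 ->
  (forall a, A a -> dotv a y <= m) ->
  forall a, polar (polar A) a -> dotv a y <= m.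
Proof.
move=> A0 Am a Aa; have : 0 <= m by have := Am 0 A0; rewrite dot0v.
rewrite le_eqVlt => /predU1P[m0|m0].
  rewrite -m0 leNgt; apply/negP => ay.
  have : dotv (2 / dotv a y *: y) a <= 1.
    apply: Aa => x Ax; rewrite dotvZr; apply: (@le_trans _ _ 0) => //.
    apply: mulr_ge0_le0; first by rewrite divr_ge0// ltW.
    by rewrite m0; exact: Am.
  by rewrite dotvZl (dotvC y) divfK ?gt_eqF//; lra.
have : dotv (m^-1 *: y) a <= 1.
  apply: Aa => x Ax; rewrite dotvZr mulrC ler_pdivrMr// mul1r; exact: Am.
by rewrite dotvZl mulrC ler_pdivrMr// mul1r dotvC.
Qed.

Lemma polar_sum_bipolar A B : A 0 -> B 0 ->
  polar (convex_body_sum (polar (polar A)) (polar (polar B))) =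
  polar (minkowski_sum A B).
Proof.
move=> A0 B0; rewrite /convex_body_sum polar_closure.
have bipolar C : C `<=` polar (polar C).
  by move=> x Cx z Cz; rewrite dotvC; exact: Cz.
apply/seteqP; split=> y H _ [a [b [Aa Bb ->]]].
  by apply: H; exists a, b; split=> //; exact: bipolar.
(* The halfspace bound is extended from B to its bipolar, then from A. *)
have AB a' : A a' -> dotv a' y <= 1 - dotv b y.
  move=> Aa'; suff : dotv b y <= 1 - dotv a' y by lra.
  apply: (bipolar_halfspace B0 _ Bb) => b' Bb'.
  have := H (a' + b'); rewrite dotvDl => H'.
  suff : dotv a' y + dotv b' y <= 1 by lra.
  by apply: H'; exists a', b'.
by have := bipolar_halfspace A0 AB Aa; rewrite dotvDl; lra.
Qed.

End PolarSum.

(** * The two statements *)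

Theorem corollary15 (R : realType) (n : nat) :
  (forall K T : set 'rV[R]_n, reciprocal_body K -> reciprocal_body T ->
     reciprocal_body (polar (convex_body_sum (polar K) (polar T)))) /\
  (forall K T : set 'rV[R]_n, convex_body K -> convex_body T ->
     convex_body (Phi (minkowski_sum (Phi K) (Phi T)))).
Proof.
have reciprocalE (K : set 'rV[R]_n) :
    convex_body K -> reciprocal K = polar (flower K).
  by move=> [_ _ K0]; apply/seteqP; split=> y /(mem_reciprocal _ K0).
split=> [_ _ [K bK ->] [T bT ->]|K T bK bT].
  rewrite !reciprocalE//.
  have [[_ _ K0] [_ _ T0]] := (bK, bT).
  set S := minkowski_sum (flower K) (flower T).
  have sS : star_set S.
    by apply: star_set_minkowski_sum; exact: star_set_flower.
  have bC : convex_body (Phi S) by exact: convex_body_Phi_sum_flower.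
  have bL := convex_body_polar (Phi S); have [_ _ L0] := bL.
  exists (polar (Phi S)) => //.
  rewrite reciprocalE// polar_sum_bipolar//; try exact: flower0.
  apply/seteqP; split; apply: polar_shrinks_into.
    apply: sub_shrinks_into_trans (PhiPhi_shrinks_into sS).
    exact: flower_polar_sub_Phi (convex_body_star_set bC).
  apply: sub_shrinks_into_trans (Phi_shrinks_into_flower bC).
  exact: sub_PhiPhi.
have [[_ _ K0] [_ _ T0]] := (convex_body_polar K, convex_body_polar T).
have sK := convex_body_star_set bK; have sT := convex_body_star_set bT.
set S := minkowski_sum (flower (polar K)) (flower (polar T)).
have sS : star_set S by apply: star_set_minkowski_sum; exact: star_set_flower.
have sP : star_set (minkowski_sum (Phi K) (Phi T)).
  by apply: star_set_minkowski_sum; apply: (star_body_Phi _).1.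
suff -> : Phi (minkowski_sum (Phi K) (Phi T)) = Phi S.
  exact: convex_body_Phi_sum_flower.
apply/seteqP; split; apply: Phi_shrinks_into => //.
  apply: subset_shrinks_into => // _ [x [y [Kx Ty ->]]]; exists x, y.
  by split=> //; exact: flower_polar_sub_Phi.
by apply: shrinks_into_sum; exact: Phi_shrinks_into_flower.
Qed.
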